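(* Let $S_0\in\mathbb{N}_+^*$ and let $S_{i+1}=f(S_i)$ for all $i\ge 0$. Then the pre-period of the sequence $(S_i)_{i\ge 0}$ is at most $2\max S_1+60$.
   Context: $\mathbb{N}_+^*$ denotes the set of finite nonempty multisets of positive integers. For a multiset $S$: $[S]$ is the set of distinct elements of $S$; $\mathrm{mult}_S(x)$ is the multiplicity of $x$ in $S$; $\mu(S)$ is the multiset of multiplicities, having one entry $\mathrm{mult}_S(x)$ for each $x\in[S]$; $A+B$ is the multiset sum (multiplicities add). The map is $f(S)=[S]+\mu(S)$ (e.g. $f(\{1,1,3,8\})=\{1,1,1,2,3,8\}$). A multiset $S$ is a member of an Inventory Loop if $f^k(S)=S$ for some $k\ge 1$. The pre-period of $(S_i)_{i\ge0}$ is the least $p\ge 0$ such that $S_p$ is a member of an Inventory Loop. $\max S$ is the largest element of $S$. *)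

(* Defs.v *)
From mathcomp Require Import all_boot.
From mathcomp Require Import finmap multiset.

Set Implicit Arguments.
Unset Strict Implicit.
Unset Printing Implicit Defensive.

Local Open Scope fset_scope.
Local Open Scope mset_scope.
Local Open Scope nat_scope.

(* For S : {mset nat}, [S x] is the multiplicity of x in S, and [finsupp S] is
   the finite set of distinct elements of S, enumerated without repetition. *)

Definition pos_mset (S : {mset nat}) : bool := (S != mset0) && (0 \notin S).

Definition distinct (S : {mset nat}) : {mset nat} := seq_mset (finsupp S).

Definition mults (S : {mset nat}) : {mset nat} :=
  seq_mset [seq S x | x <- finsupp S].

Definition inventory (S : {mset nat}) : {mset nat} := distinct S `+` mults S.

Definition in_inventory_loop (S : {mset nat}) : Prop :=
  exists2 k, 1 <= k & iter k inventory S = S.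

Definition is_preperiod (S : nat -> {mset nat}) (p : nat) : Prop :=
  in_inventory_loop (S p) /\ forall q, in_inventory_loop (S q) -> p <= q.

(* The largest element of S; the junk value 0 is taken only at mset0. *)
Definition mset_max (S : {mset nat}) : nat := \max_(x <- S) x.

(* The map restricts to finite nonempty multisets of positive integers, so it
   is harmless to define it on all of {mset nat}. *)
Lemma pos_mset_inventory (S : {mset nat}) :
  pos_mset S -> pos_mset (inventory S).
Proof.
case/andP=> S0 S0N; have memE y s : (y \in seq_mset s) = (y \in s).
  exact: perm_mem (perm_eq_seq_mset s) y.
apply/andP; split; last first.
  rewrite in_msetD !memE negb_or msuppE S0N /=.
  by apply/mapP=> -[x]; rewrite mem_finsupp => /eqP xN /esym /xN.
apply: contraNneq S0 => f0; apply/eqP/msetP => x; rewrite mset0E.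
apply/eqP; rewrite mset_eq0; apply/negP => xS.
have : x \in inventory S by rewrite in_msetD memE msuppE xS.
by rewrite f0 in_mset0.
Qed.

(* Main.v *)
(* Let n_i be the number of distinct elements of S_i and q_i the multiset of its
   multiplicities that are at least 2. Distinct elements are never lost, and S_(i+1)
   depends only on the distinct elements of S_i and on q_i, so a repetition of
   (n_i, q_i) closes a loop one step later. It remains to force a repetition.

   While n_i < 10, eight consecutive times with the same n_i contain a repetition, by
   a finite check; so without repetition n_i >= 10 from time 64 on.

   If k distinct multiplicities at least 2 occur in S_(i+1) on elements other than 1,
   then their excesses over 1 are distinct and sum to at most |q_i|, whence
   k(k+1)/2 <= |q_i|. Moreover |q_(i+2)| <= k + 2, so |q_(i+2)| <= max(4, |q_i| - 1),
   and |q_i| <= 4 from time 2 n_0 on.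

   After that, q_i consists of n - o for some small o (the multiplicity of 1) and at
   most three values in [2, 5]. What happens next depends only on which of these
   values are already present; each absent one is added and increases n. Relative to
   n this is a finite nondeterministic automaton, whose states also record what is
   known about the presence of n-1, n-2, n-3 and of 2, ..., 5. A potential with
   values at most 6 shows that t steps without repetition increase n by at least
   about t / 2, while n never exceeds max(max S_1 + 1, 7). *)
Require Import Defs.
From mathcomp Require Import all_boot.
From mathcomp Require Import finmap multiset.
From mathcomp Require Import zify.

Local Open Scope mset_scope.
Local Open Scope nat_scope.

(** * Repeated multiplicities and one inventory step *)

Definition ndistinct (A : {mset nat}) : nat := size (finsupp A).

Definition mult_seq (A : {mset nat}) : seq nat := [seq A x | x <- finsupp A].

Definition repeats (A : {mset nat}) : seq nat := [seq v <- mult_seq A | 1 < v].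

Lemma size_mult_seq (A : {mset nat}) : size (mult_seq A) = ndistinct A.
Proof. by rewrite size_map. Qed.

Lemma mult_seq_gt0 (A : {mset nat}) (v : nat) : v \in mult_seq A -> 0 < v.
Proof. by case/mapP=> x; rewrite msuppE -mset_gt0 => ? ->. Qed.

Lemma mem_repeats (A : {mset nat}) (v : nat) :
  (v \in repeats A) = (1 < v) && (v \in mult_seq A).
Proof. by rewrite mem_filter. Qed.

Lemma size_repeats (A : {mset nat}) : size (repeats A) <= ndistinct A.
Proof. by rewrite size_filter -size_mult_seq count_size. Qed.

Lemma count_mult_seq1 (A : {mset nat}) :
  count_mem 1 (mult_seq A) = ndistinct A - size (repeats A).
Proof.
rewrite -size_mult_seq size_filter -(count_predC (ltn 1)) addKn.
apply: eq_in_count => v /mult_seq_gt0 /=; lia.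
Qed.

Lemma count_repeats (A : {mset nat}) (v : nat) :
  1 < v -> count_mem v (repeats A) = count_mem v (mult_seq A).
Proof.
move=> v1; rewrite count_filter; apply: eq_count => u /=.
by case: eqP => // ->; rewrite v1.
Qed.

Lemma inventoryE (A : {mset nat}) (x : nat) :
  inventory A x = (x \in A) + count_mem x (mult_seq A).
Proof.
by rewrite msetE2 !mset_seqE -/(mult_seq A) count_uniq_mem // msuppE.
Qed.

Lemma inventory1E (A : {mset nat}) :
  inventory A 1 = (1 \in A) + (ndistinct A - size (repeats A)).
Proof. by rewrite inventoryE count_mult_seq1. Qed.

Lemma inventory_repeatsE (A : {mset nat}) (x : nat) :
  x \in repeats A -> inventory A x = (x \in A) + count_mem x (repeats A).
Proof.
by rewrite mem_repeats => /andP[x1 _]; rewrite inventoryE count_repeats.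
Qed.

Lemma mem_inventory (A : {mset nat}) (x : nat) :
  (x \in inventory A) = (x \in A) || (x \in mult_seq A).
Proof.
by rewrite in_mset inventoryE addn_gt0 lt0b -has_count has_pred1.
Qed.

(* Only elements that were multiplicities before the step can have multiplicity
   at least 2 after it. *)
Lemma repeats_inventory (A : {mset nat}) :
  perm_eq (repeats (inventory A))
    [seq v <- [seq inventory A x | x <- 1 :: undup (repeats A)] | 1 < v].
Proof.
rewrite {1}/repeats /mult_seq !filter_map; apply/perm_map/uniq_perm.
- by rewrite filter_uniq.
- by rewrite filter_uniq //= mem_undup mem_repeats undup_uniq.
move=> x; rewrite !mem_filter /= inE mem_undup mem_repeats.
case: (boolP (1 < inventory A x)) => //= fx1.
rewrite msuppE in_mset (ltnW fx1).
have xU : x \in mult_seq A.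
  rewrite -has_pred1 has_count; move: fx1; rewrite inventoryE.
  by case: (x \in A) => //= /ltnW.
rewrite xU andbT; have := mult_seq_gt0 _ _ xU; lia.
Qed.

Lemma perm_finsupp_inventory (A : {mset nat}) :
  perm_eq (finsupp (inventory A))
    (finsupp A ++ [seq x <- undup (mult_seq A) | x \notin A]).
Proof.
apply: uniq_perm => //.
  rewrite cat_uniq fset_uniq filter_uniq ?undup_uniq // andbT.
  by apply/hasPn=> x; rewrite mem_filter /= msuppE => /andP[].
move=> x; rewrite msuppE mem_inventory mem_cat mem_filter mem_undup msuppE.
by case: (x \in A).
Qed.

Lemma ndistinct_inventory (A : {mset nat}) :
  ndistinct (inventory A) = ndistinct A + count [predC A] (undup (mult_seq A)).
Proof.
by rewrite /ndistinct (perm_size (perm_finsupp_inventory A)) size_cat size_filter.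
Qed.

Lemma perm_undup_mult_seq (A : {mset nat}) :
  perm_eq (undup (mult_seq A))
    (nseq (size (repeats A) < ndistinct A) 1 ++ undup (repeats A)).
Proof.
have n1 : 1 \notin undup (repeats A) by rewrite mem_undup mem_repeats.
have m1 : (1 \in mult_seq A) = (size (repeats A) < ndistinct A).
  by rewrite -has_pred1 has_count count_mult_seq1 subn_gt0.
apply: uniq_perm; rewrite ?undup_uniq //.
  by case: ltnP => _; rewrite /= ?n1 undup_uniq.
move=> x; rewrite mem_cat !mem_undup mem_repeats mem_nseq -m1 lt0b.
case: (ltngtP x 1) => [||->] //=; last by rewrite andbT orbF.
  by case: x => // _; rewrite andbF; apply/negP=> /mult_seq_gt0.
by rewrite andbF.
Qed.

Lemma size_undup_mult_seq (A : {mset nat}) :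
  size (undup (mult_seq A)) = (size (repeats A) < ndistinct A) + size (undup (repeats A)).
Proof. by rewrite (perm_size (perm_undup_mult_seq A)) size_cat size_nseq. Qed.

Lemma sumn_mult_seq (A : {mset nat}) : sumn (mult_seq A) = size A.
Proof.
rewrite sumn_map -sum1_size (sum_mset A xpredT (fun=> 1)).
by apply: eq_bigr => i _; rewrite muln1.
Qed.

Lemma sumn_mult_seq_inventory (A : {mset nat}) :
  sumn (mult_seq (inventory A)) = (ndistinct A).*2.
Proof.
rewrite sumn_mult_seq.
have -> : inventory A = seq_mset (finsupp A ++ mult_seq A).
  by apply/msetP=> x; rewrite msetE2 !mset_seqE count_cat.
by rewrite (perm_size (perm_eq_seq_mset _)) size_cat size_mult_seq addnn.
Qed.

Lemma sumn_predn (s : seq nat) :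
  {in s, forall v, 0 < v} -> sumn (map predn s) + size s = sumn s.
Proof.
elim: s => //= x s IH s0; have := s0 x (mem_head _ _).
have := IH (fun v vs => s0 v (mem_behead (s := x :: s) vs)); lia.
Qed.

Lemma perm_mult_seq (A : {mset nat}) :
  perm_eq (mult_seq A) (nseq (ndistinct A - size (repeats A)) 1 ++ repeats A).
Proof.
rewrite -count_mult_seq1 perm_sym.
apply: perm_trans (permEl (perm_filterC (pred1 1) (mult_seq A))).
have -> : [seq v <- mult_seq A | pred1 1 v] = nseq (count_mem 1 (mult_seq A)) 1.
  by rewrite -size_filter; apply/all_pred1P/filter_all.
rewrite perm_cat2l /repeats (eq_in_filter (a2 := predC (pred1 1))) //.
move=> v /mult_seq_gt0 /=; lia.
Qed.

Lemma sumn_repeats (A : {mset nat}) :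
  sumn (map predn (repeats A)) + ndistinct A = sumn (mult_seq A).
Proof.
rewrite -(sumn_predn (mult_seq A)); last by move=> v /mult_seq_gt0.
rewrite size_mult_seq (perm_sumn (perm_map _ (perm_mult_seq A))) map_cat sumn_cat.
by rewrite map_nseq sumn_nseq.
Qed.

(** The multiplicities equal to 1 need not be compared: their number is the number of distinct
    elements minus the number of repeats. *)
Lemma inventory_inj (A B : {mset nat}) :
  finsupp A = finsupp B -> perm_eq (repeats A) (repeats B) -> inventory A = inventory B.
Proof.
move=> fAB rAB; rewrite /inventory /distinct /mults -/(mult_seq A) -/(mult_seq B) fAB.
congr (_ `+` _); apply/eq_seq_msetP.
rewrite (perm_trans (perm_mult_seq A)) // perm_sym (perm_trans (perm_mult_seq B)) //.
by rewrite /ndistinct fAB (perm_size rAB) perm_cat2l perm_sym.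
Qed.

(** * Bounds on multiplicities *)

Lemma uniq_sumn_ge (s : seq nat) :
  uniq s -> {in s, forall v, 0 < v} -> size s * (size s).+1 <= (sumn s).*2.
Proof.
move en : (size s) => n; elim: n s en => [|n IH] s sz us s0 //.
have /hasP[x xs xn] : has (leq n.+1) s.
  apply/negPn/negP=> /hasPn small.
  have /(uniq_leq_size us) : {subset s <= iota 1 n}.
    by move=> v vs; rewrite mem_iota s0 //=; have := small v vs; rewrite -ltnNge.
  by rewrite size_iota sz ltnn.
have := IH (rem x s); rewrite size_rem // sz rem_uniq // => /(_ erefl isT).
have -> : sumn s = x + sumn (rem x s) by rewrite (perm_sumn (perm_to_rem xs)).
by move=> /(_ (fun v vs => s0 v (mem_rem vs))); nia.
Qed.

Lemma sumn_map_le (T : eqType) (f g : T -> nat) (s : seq T) :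
  {in s, forall x, f x <= g x} -> sumn (map f s) <= sumn (map g s).
Proof.
elim: s => //= x s IH fg; rewrite leq_add ?fg ?mem_head // IH // => y ys.
by rewrite fg // inE ys orbT.
Qed.

Lemma sumn_count_undup (s : seq nat) :
  sumn [seq count_mem x s | x <- undup s] = size s.
Proof.
rewrite -[RHS](perm_size (perm_count_undup s)) size_flatten /shape -map_comp.
by congr sumn; apply: eq_map => x /=; rewrite size_nseq.
Qed.

Lemma leq_ndistinct_inventory (A : {mset nat}) : ndistinct A <= ndistinct (inventory A).
Proof. by rewrite ndistinct_inventory leq_addr. Qed.

(* The new multiplicity of 1, the only one that may be large, is left out, as 1 is
   not in [repeats A]. *)
Definition small_repeats (A : {mset nat}) : seq nat :=
  [seq v <- [seq inventory A x | x <- undup (repeats A)] | 1 < v].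

Lemma perm_small_repeats (A : {mset nat}) :
  perm_eq (repeats (inventory A))
    ([seq v <- [:: inventory A 1] | 1 < v] ++ small_repeats A).
Proof. by rewrite -filter_cat /=; apply: repeats_inventory. Qed.

Lemma small_repeats_gt1 (A : {mset nat}) : {in small_repeats A, forall v, 1 < v}.
Proof. by move=> v; rewrite mem_filter => /andP[]. Qed.

(** The excess of [inventory A x] over 1 is at most the count of [x] in [repeats A], and these
    counts add up to the size. *)
Lemma sumn_small_repeats (A : {mset nat}) :
  sumn (map predn (small_repeats A)) <= size (repeats A).
Proof.
rewrite -sumn_count_undup /small_repeats.
have -> (t : seq nat) : sumn (map predn [seq v <- t | 1 < v]) = sumn (map predn t).
  by elim: t => //= x t <-; case: ltnP => /=; lia.
rewrite -map_comp; apply: sumn_map_le => x; rewrite mem_undup => /inventory_repeatsE /= ->.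
by case: (x \in A); lia.
Qed.

Lemma size_repeats_inventory (A : {mset nat}) :
  size (repeats (inventory A)) <= size (undup (mult_seq A)).
Proof.
rewrite (perm_size (perm_small_repeats A)) size_cat size_undup_mult_seq leq_add //.
  rewrite /= inventory1E; case: ltnP => //=.
  by case: ltnP => //; case: (1 \in A); lia.
by rewrite size_filter (leq_trans (count_size _ _)) ?size_map.
Qed.

Lemma size_undup_cat (T : eqType) (s t : seq T) :
  size (undup (s ++ t)) <= size (undup s) + size (undup t).
Proof. by rewrite undup_cat size_cat leq_add2r size_filter count_size. Qed.

(* k distinct multiplicities at least 2 carry a total excess of at least
   1 + ... + k, which is bounded by the number of repeated elements two steps before. *)
Lemma size_repeats_inventory2 (A : {mset nat}) :
  size (repeats (inventory (inventory A))) <= maxn 4 (size (repeats A)).-1.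
Proof.
set k := size (undup (small_repeats A)).
have e2 : size (repeats (inventory (inventory A))) <= 2 + k.
  have le1k : size (undup (repeats (inventory A))) <= 1 + k.
    rewrite (perm_size (perm_undup (perm_mem (perm_small_repeats A)))).
    apply: (leq_trans (size_undup_cat _ _ _)); rewrite leq_add2r.
    by apply: (leq_trans (size_undup _)); rewrite size_filter count_size.
  apply: (leq_trans (size_repeats_inventory _)); rewrite size_undup_mult_seq; lia.
have : k * k.+1 <= (size (repeats A)).*2.
  have := uniq_sumn_ge (map predn (undup (small_repeats A))).
  rewrite size_map -/k map_inj_in_uniq ?undup_uniq => [|u v].
    move=> /(_ isT) H; apply: (leq_trans (H _)).
      move=> u /mapP[v]; rewrite mem_undup => /small_repeats_gt1 v1 ->; lia.
    rewrite leq_double; apply: leq_trans (sumn_small_repeats A).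
    elim: (small_repeats A) => //= x s IH; case: ifP => /= _; lia.
  rewrite !mem_undup => /small_repeats_gt1 u1 /small_repeats_gt1 v1; lia.
(* For k >= 3, k + 2 <= k(k+1)/2 - 1; otherwise k + 2 <= 4. *)
by move: e2; case: (ltnP k 3) => k3; nia.
Qed.

Lemma size_repeats_iter (A : {mset nat}) (i : nat) :
  size (repeats (iter i inventory A)) <= maxn 4 (ndistinct A - i./2).
Proof.
have [m] := ubnP i; elim: m i => // m IH [|[|i]] im.
- by rewrite subn0 (leq_trans (size_repeats _)) // leq_maxr.
- apply: (leq_trans (size_repeats_inventory _)).
  by rewrite (leq_trans (size_undup _)) // size_mult_seq subn0 leq_maxr.
have := size_repeats_inventory2 (iter i inventory A); have := IH i.
by rewrite /= -!iterS; lia.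
Qed.

Lemma inventory_le (A : {mset nat}) (x : nat) : inventory A x <= (ndistinct A).+1.
Proof.
rewrite inventoryE -add1n leq_add ?leq_b1 //.
by rewrite -size_mult_seq count_size.
Qed.

Lemma mult_seq_inventory_le (A : {mset nat}) :
  {in mult_seq (inventory A), forall v, v <= (ndistinct A).+1}.
Proof. by move=> v /mapP[x _ ->]; apply: inventory_le. Qed.

(* A multiplicity exceeding the number n of distinct elements would require all n
   previous multiplicities to coincide, hence all those before to be distinct. *)
Lemma mult_seq_inventory3_le (A : {mset nat}) (B := inventory (inventory A)) :
  {in mult_seq (inventory B), forall v, v <= maxn 7 (ndistinct B)}.
Proof.
move=> v vm; have v_le := mult_seq_inventory_le _ _ vm.
case: (ltnP (ndistinct B) v) => [Bv|]; last by lia.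
suff : ndistinct B <= 6 by lia.
case/mapP: vm => x _ vE.
have allx : all (pred1 x) (mult_seq B).
  rewrite all_count eqn_leq count_size size_mult_seq /=.
  by move: Bv; rewrite vE inventoryE; case: (x \in B) => //= /ltnW.
have Bx y : y \in B -> B y = x.
  by move=> yB; apply/eqP/(allP allx)/map_f; rewrite msuppE.
(* If [x <= 1], a repeated entry would have multiplicity at least 2 in [B]. If [x >= 2], every
   element of [B] is an entry, so there are at least as many distinct entries as entries. *)
have uA : uniq (mult_seq (inventory A)).
  have [x1|x2] := leqP x 1.
    apply: count_mem_uniq => y; case: (boolP (y \in _)) => [yA|/count_memPn -> //].
    have yB : y \in B by rewrite mem_inventory yA orbT.
    have := Bx y yB; rewrite inventoryE; move: yA; rewrite -has_pred1 has_count /=; lia.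
  have BA : {subset finsupp B <= undup (mult_seq (inventory A))}.
    move=> y; rewrite msuppE mem_undup => yB; rewrite -has_pred1 has_count.
    by move: x2; rewrite -(Bx y yB) inventoryE; case: (y \in _) => // /ltnW.
  have leB := uniq_leq_size (fset_uniq (finsupp B)) BA.
  apply/negPn; rewrite -ltn_size_undup -leqNgt size_mult_seq.
  exact: leq_trans (leq_ndistinct_inventory _) leB.
(* With k = [ndistinct (inventory A)], k(k+1) <= 4 [ndistinct A] <= 4k, so k <= 3, and [B] has at
   most 2k distinct elements. *)
have := uniq_sumn_ge _ uA (fun u => mult_seq_gt0 _ u).
rewrite sumn_mult_seq_inventory size_mult_seq => k4.
have := leq_ndistinct_inventory A.
have : ndistinct B <= (ndistinct (inventory A)).*2.
  rewrite /B ndistinct_inventory -addnn leq_add2l (leq_trans (count_size _ _)) //.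
  by rewrite (leq_trans (size_undup _)) ?size_mult_seq.
by nia.
Qed.

(** * Bounds on the elements and on their number *)

Lemma pos_mset_iter (A : {mset nat}) (i : nat) :
  pos_mset A -> pos_mset (iter i inventory A).
Proof. by move=> posA; elim: i => //= i; apply: pos_mset_inventory. Qed.

Lemma mset_max_ge (A : {mset nat}) : {in A, forall x, x <= mset_max A}.
Proof. by move=> x xA; exact: (leq_bigmax_seq (F := fun y => y) x). Qed.

Lemma ndistinct_le (A : {mset nat}) (m : nat) :
  pos_mset A -> {in A, forall x, x <= m} -> ndistinct A <= m.
Proof.
case/andP=> _ A0 Am; rewrite -(size_iota 1 m); apply: uniq_leq_size => //.
move=> x; rewrite msuppE mem_iota add1n ltnS => xA; rewrite Am // andbT lt0n.
by apply: contraNneq A0 => <-.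
Qed.

(** New elements are previous multiplicities: at first at most n + 1 with n <= max S_1, later at
    most max(7, n), where n is bounded by the induction hypothesis. *)
Lemma iter_inventory_le (A : {mset nat}) (i : nat) :
  pos_mset A ->
  {in iter i.+1 inventory A,
    forall x, x <= maxn (mset_max (inventory A)).+1 7}.
Proof.
move=> posA; set M := mset_max _.
have M1 : ndistinct (inventory A) <= M.
  by apply: ndistinct_le (mset_max_ge _); apply: pos_mset_inventory.
elim: i => [|i IH] x; first by move/mset_max_ge; rewrite -/M; lia.
rewrite iterS mem_inventory => /orP[/IH //|].
case: i IH => [|[|i]] IH.
- by move/mult_seq_inventory_le; have := leq_ndistinct_inventory A; lia.
- by move/mult_seq_inventory_le; rewrite /=; lia.
have := ndistinct_le _ _ (pos_mset_iter A i.+3 posA) IH.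
have := leq_ndistinct_inventory (iter i.+2 inventory A).
by move=> le_card le_max /mult_seq_inventory3_le; move: le_card le_max; rewrite -!iterS; lia.
Qed.

Lemma ndistinct_iter_le (A : {mset nat}) (i : nat) :
  pos_mset A ->
  ndistinct (iter i inventory A) <= maxn (mset_max (inventory A)).+1 7.
Proof.
move=> posA; apply: leq_trans (leq_ndistinct_inventory _) _; rewrite -iterS.
by apply: ndistinct_le; [exact: pos_mset_iter | exact: iter_inventory_le].
Qed.

(** * Recurrence and the case of few distinct elements *)

Lemma leq_ndistinct_iter (A : {mset nat}) (i j : nat) :
  i <= j -> ndistinct (iter i inventory A) <= ndistinct (iter j inventory A).
Proof.
move=> /subnK <-; elim: (j - i) => // k IH.
by rewrite addSn iterS (leq_trans IH) ?leq_ndistinct_inventory.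
Qed.

Lemma mem_iter_inventory (A : {mset nat}) (i j x : nat) :
  i <= j -> x \in iter i inventory A -> x \in iter j inventory A.
Proof.
move=> /subnK <- xi; elim: (j - i) => // k IH.
by rewrite addSn iterS mem_inventory IH.
Qed.

(* Two times with the same number of distinct elements have the same distinct
   elements, since these only accumulate. *)
Definition recurs (A : {mset nat}) (t : nat) : Prop :=
  exists i j : nat, [/\ i < j, j <= t,
    ndistinct (iter i inventory A) = ndistinct (iter j inventory A)
    & perm_eq (repeats (iter i inventory A)) (repeats (iter j inventory A))].

Lemma recurs_preperiod (A : {mset nat}) (t : nat) :
  recurs A t ->
  exists p, is_preperiod (fun i => iter i inventory A) p /\ p <= t.
Proof.
case=> i [j] [ij jt eq_card eq_rep].
have eqS : iter i.+1 inventory A = iter j.+1 inventory A.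
  rewrite !iterS; apply: inventory_inj => //; apply/eqP; rewrite eqEfcard.
  apply/andP; split; last by rewrite -/(ndistinct _) -eq_card.
  apply/fsubsetP=> x; rewrite !msuppE; exact: mem_iter_inventory (ltnW ij).
pose d := j - i; pose per q := iter (d + q) inventory A == iter q inventory A.
have perS q r : q <= r -> per q -> per r.
  move=> /subnK <- /eqP pq; apply/eqP; elim: (r - q) => // k IH.
  by rewrite addSn addnS !iterS IH.
have peri : per i.+1 by rewrite /per addnS subnK ?(ltnW ij) // eqS.
(* A loop through time [q] returns at arbitrarily late times, where period [d] already holds. *)
have loopE q : in_inventory_loop (iter q inventory A) <-> per q.
  split=> [[k k1 fk]|/eqP pq]; last by exists d; rewrite ?subn_gt0 // -iterD.
  have iterk m : iter (m * k) inventory (iter q inventory A) = iter q inventory A.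
    by elim: m => // m IH; rewrite mulSn iterD IH.
  have : per (i.+1 * k + q) by apply: (perS i.+1) => //; nia.
  by rewrite /per !iterD iterk fk.
case: (ex_minnP (ex_intro (fun q => is_true (per q)) _ peri)) => p perp minp.
exists p; split; last by apply: leq_trans (minp _ peri) _; lia.
by split=> [|q /loopE /minp //]; apply/loopE.
Qed.

(* The evolution of [repeats] while no new element appears. *)
Definition static_next (n : nat) (q : seq nat) : seq nat :=
  sort leq [seq v <- (n - size q).+1 :: [seq (count_mem x q).+1 | x <- undup q] | 1 < v].

Lemma repeats_static (A : {mset nat}) (q : seq nat) :
  ndistinct (inventory A) = ndistinct A -> perm_eq (repeats A) q ->
  perm_eq (repeats (inventory A)) (static_next (ndistinct A) q).
Proof.
move=> /eqP; rewrite ndistinct_inventory -[X in _ == X]addn0 eqn_add2l -leqn0 leqNgt -has_count.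
move=> /hasPn inA Aq; rewrite /static_next perm_sym perm_sort perm_sym.
apply: perm_trans (repeats_inventory A) _.
have inA' x : x \in mult_seq A -> x \in A.
  by move=> xm; have := inA x; rewrite mem_undup negbK; apply.
rewrite /= inventory1E (perm_size Aq).
have -> : [seq inventory A x | x <- undup (repeats A)] =
          [seq (count_mem x q).+1 | x <- undup (repeats A)].
  apply/eq_in_map => x; rewrite mem_undup => xr.
  rewrite inventory_repeatsE // (permP Aq) inA' //.
  by move: xr; rewrite mem_repeats => /andP[].
have tailP := perm_filter (ltn 1) (perm_map (fun x => (count_mem x q).+1)
  (perm_undup (perm_mem Aq))).
(* If no multiplicity is 1, then 1 may be absent, but both values for its new multiplicity are at
   most 1 and get filtered out. *)
case: (ltnP (size q) (ndistinct A)) => [lt_q|ge_q].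
  by rewrite inA' ?add1n ?ltnS ?subn_gt0 ?lt_q ?perm_cons // -has_pred1 has_count
    count_mult_seq1 (perm_size Aq) subn_gt0.
by move: ge_q; rewrite -subn_eq0 => /eqP ->; case: (1 \in A).
Qed.

(* Nondecreasing sequences with entries at least lo and sum at most n; f is fuel. *)
Fixpoint partitions (f lo n : nat) : seq (seq nat) :=
  if f is f'.+1 then
    [::] :: flatten [seq map (cons k) (partitions f' k (n - k)) | k <- iota lo (n.+1 - lo)]
  else [:: [::]].

Lemma mem_partitions (f lo n : nat) (s : seq nat) :
  0 < lo -> n <= f -> path leq lo s -> sumn s <= n -> s \in partitions f lo n.
Proof.
elim: f lo n s => [|f IH] lo n [|k s] //= lo0 nf /andP[lok ks] sn.
  by move: lo0 lok sn nf; lia.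
rewrite inE; apply/flatten_mapP; exists k; first by rewrite mem_iota; lia.
by apply/map_f/IH => //; lia.
Qed.

Lemma sort_partitions (q : seq nat) (n : nat) :
  {in q, forall v, 1 < v} -> sumn (map predn q) <= n ->
  exists2 s, s \in partitions n 1 n & sort leq q = map S s.
Proof.
move=> q1 qn; have sq1 : {in sort leq q, forall v, 1 < v}.
  by move=> v; rewrite mem_sort => /q1.
exists (map predn (sort leq q)); last first.
  by rewrite -map_comp -[LHS]map_id; apply/eq_in_map => v /sq1 /=; lia.
apply: mem_partitions => //; last by rewrite (perm_sumn (perm_map _ (permEl (perm_sort _ _)))).
rewrite path_min_sorted; last by apply/allP=> v /mapP[u /sq1 u1 ->]; lia.
rewrite sorted_map; apply: sub_sorted (sort_sorted leq_total _) => u v /=; lia.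
Qed.

(** The lists [s] are the possible sorted excesses over 1, of sum at most [n]. *)
Lemma static_orbits_short :
  all (fun n => all (fun s => ~~ uniq (traject (static_next n) (map S s) 8))
                    (partitions n 1 n)) (iota 1 9).
Proof. by vm_compute. Qed.

(** The window starts at time [i.+1] because the bound on the total excess uses a preceding step. *)
Lemma recurs_static (A : {mset nat}) (i : nat) (n := ndistinct (iter i.+1 inventory A)) :
  0 < n -> n < 10 -> ndistinct (iter (i + 8) inventory A) = n -> recurs A (i + 8).
Proof.
move=> n0 n10 nE; pose q := sort leq (repeats (iter i.+1 inventory A)).
have ndistinct_n k : k <= 7 -> ndistinct (iter (i.+1 + k) inventory A) = n.
  move=> k7; apply/eqP; rewrite eqn_leq -{1}nE !leq_ndistinct_iter //; lia.
have orb k : k <= 7 ->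
    perm_eq (repeats (iter (i.+1 + k) inventory A)) (iter k (static_next n) q).
  elim: k => [|k IH] k7; first by rewrite addn0 perm_sym perm_sort.
  have := repeats_static _ _ _ (IH (ltnW k7)).
  by rewrite -iterS -addnS !ndistinct_n ?(ltnW k7) //; apply.
have : ~~ uniq (traject (static_next n) q 8).
  have /allP/(_ n) := static_orbits_short; rewrite mem_iota n0 n10 => /(_ isT).
  have [||p pn qE] := sort_partitions (repeats (iter i.+1 inventory A)) n.
  - by move=> v; rewrite mem_repeats => /andP[].
  - have := sumn_repeats (inventory (iter i inventory A)).
    have := leq_ndistinct_inventory (iter i inventory A).
    rewrite sumn_mult_seq_inventory -iterS -/n => le_n sum_n.
    by rewrite -(leq_add2r n) sum_n addnn leq_double.
  by rewrite /q qE => /allP; apply.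
case/(uniqPn q) => a [b] [ab]; rewrite size_traject => b8.
rewrite !nth_traject //; last exact: ltn_trans b8.
move=> eq_ab; exists (i.+1 + a), (i.+1 + b); split; rewrite ?ndistinct_n //; try lia.
by rewrite (perm_trans (orb a _)) 1?perm_sym ?eq_ab ?orb //; lia.
Qed.

(** Successive windows of eight times share an endpoint, so each new element costs at most seven
    steps. *)
Lemma ndistinct_grows (A : {mset nat}) (k : nat) :
  0 < ndistinct (inventory A) -> ~ recurs A (7 * k).+1 ->
  minn 10 (ndistinct (inventory A) + k) <= ndistinct (iter (7 * k).+1 inventory A).
Proof.
move=> n0; elim: k => [|k IH] nrec; first by rewrite muln0 addn0 geq_minr.
have {}IH : minn 10 (ndistinct (inventory A) + k) <= ndistinct (iter (7 * k).+1 inventory A).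
  apply: IH => -[i [j [ij jk eqc eqr]]]; apply: nrec; exists i, j; split => //; lia.
have eq8 : (7 * k.+1).+1 = 7 * k + 8 by lia.
rewrite eq8 in nrec *; have := leq_ndistinct_iter A (7 * k).+1 (7 * k + 8).
have [lt10|] := ltnP (ndistinct (iter (7 * k).+1 inventory A)) 10; last by lia.
have pos : 0 < ndistinct (iter (7 * k).+1 inventory A) by lia.
have rec := recurs_static A (7 * k) pos lt10.
case: (ndistinct (iter (7 * k + 8) inventory A) =P ndistinct (iter (7 * k).+1 inventory A)).
  by move/rec/nrec.
lia.
Qed.

(** * The automaton for many distinct elements *)

(* (s, o, (K, C)) stands for a multiset with n distinct elements, among them 1,
   whose repeated multiplicities are s and n - o, the last one being that of 1;
   the n - k with k \in K and the elements of C are known to be present. *)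
Definition rel_state : Type := (seq nat * nat) * (seq nat * seq nat).

Definition represents (A : {mset nat}) (st : rel_state) : Prop :=
  let: (s, o, (K, C)) := st in
  [/\ [/\ 1 \in A, 10 <= ndistinct A, o + 6 <= ndistinct A & size s <= 3],
      perm_eq (repeats A) (ndistinct A - o :: s),
      {in s, forall v, v \in iota 2 4},
      {in K, forall k, ndistinct A - k \in A} & {in C, forall x, x \in A}].

Definition known (st : rel_state) : bool :=
  let: (s, o, (K, C)) := st in (o \in K) && all (mem C) s.

(* Here a tells whether n - o is present and ys lists the absent elements of s:
   absent elements are added, so n grows. *)
Definition growth (a : bool) (ys : seq nat) : nat := ~~ a + size ys.

(** The multiplicity of n - o becomes [a.+1] and that of 1 becomes n - |s|. Offsets are shifted by
    [g], as n grows by [g]; truncating the known sets keeps the automaton finite. *)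
Definition rel_next (a : bool) (ys : seq nat) (st : rel_state) : rel_state :=
  let: (s, o, (K, C)) := st in
  let g := growth a ys in
  (sort leq [seq v <- a.+1 :: [seq (x \notin ys) + count_mem x s | x <- undup s]
             | 1 < v],
   g + size s,
   ([seq k <- iota 1 3 | (g <= k) && ((k - g == o) || (k - g \in K))],
    [seq x <- iota 2 4 | (x \in C) || (x \in s)])).

Fixpoint sublists (s : seq nat) : seq (seq nat) :=
  if s is x :: s' then sublists s' ++ map (cons x) (sublists s') else [:: [::]].

Lemma mem_sublists (P : pred nat) (s : seq nat) : filter P s \in sublists s.
Proof.
elim: s => //= x s IH; rewrite mem_cat; case: (P x); last by rewrite IH.
by rewrite map_f ?orbT.
Qed.

Definition rel_succ (st : rel_state) : seq (nat * rel_state) :=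
  let: (s, o, (K, C)) := st in
  [seq (growth a ys, rel_next a ys st)
     | a <- if o \in K then [:: true] else [:: true; false],
       ys <- sublists [seq x <- undup s | x \notin C]].

(** A forced return, without growth, after one or two steps. *)
Definition cyclic (st : rel_state) : bool :=
  let st1 := rel_next true [::] st in
  let st2 := rel_next true [::] st1 in
  known st && ((st1 == st) || known st1 && (st2 == st)).

Lemma represents_perm (A B : {mset nat}) (st : rel_state) :
  represents A st -> represents B st -> ndistinct A = ndistinct B ->
  perm_eq (repeats A) (repeats B).
Proof.
case: st => [[s o] [K C]] [_ permA _ _ _] [_ permB _ _ _] eqAB.
by apply: perm_trans permA _; rewrite perm_sym eqAB.
Qed.

Lemma represents_next (A : {mset nat}) (st : rel_state) :
  represents A st -> size (repeats (inventory A)) <= 4 ->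
  let: (s, o, (K, C)) := st in
  let a := ndistinct A - o \in A in
  let ys := [seq x <- undup s | x \notin A] in
  ndistinct (inventory A) = ndistinct A + growth a ys /\
  represents (inventory A) (rel_next a ys st).
Proof.
case: st => [[s o] [K C]] [[A1 n10 o6 s3] permA s_small KA CA] size4 a ys.
set n := ndistinct A in n10 o6 permA KA a *.
(* n - o >= 6 exceeds all entries of [s]. *)
have no_s : n - o \notin s.
  by apply/negP=> /s_small; rewrite mem_iota; lia.
have s_gt1 : {in s, forall v, 1 < v <= 5}.
  by move=> v /s_small; rewrite mem_iota; lia.
have mem_rep x : (x \in repeats A) = (x == n - o) || (x \in s).
  by rewrite (perm_mem permA) inE.
have mem_mult x : x \in repeats A -> x \in mult_seq A.
  by rewrite mem_repeats => /andP[].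
have permU : perm_eq (undup (repeats A)) (n - o :: undup s).
  by rewrite (perm_trans (perm_undup (perm_mem permA))) //= (negPf no_s).
have size_rep : size (repeats A) = (size s).+1 by rewrite (perm_size permA).
have n'E : ndistinct (inventory A) = n + growth a ys.
  rewrite ndistinct_inventory (permP (perm_undup_mult_seq A)) count_cat.
  rewrite (permP permU) /= count_nseq /= A1 mul0n add0n.
  by rewrite /growth /ys size_filter.
split=> //; rewrite /rel_next.
set s' := sort _ _.
have inv1 : inventory A 1 = n - size s.
  by rewrite inventory1E A1 size_rep -/n; lia.
have perm' : perm_eq (repeats (inventory A)) (n - size s :: s').
  apply: perm_trans (repeats_inventory A) _.
  rewrite /= inv1 ifT; last by lia.
  rewrite perm_cons perm_sym perm_sort.
  rewrite perm_sym; apply: perm_trans (perm_filter _ (perm_map _ permU)) _.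
  have -> : [seq inventory A x | x <- n - o :: undup s] =
     a.+1 :: [seq (x \notin ys) + count_mem x s | x <- undup s].
    rewrite /= inventory_repeatsE ?mem_rep ?eqxx // (permP permA) /= eqxx.
    rewrite (count_memPn no_s) addn0 addn1 -/a; congr cons.
    apply/eq_in_map => x; rewrite mem_undup => xs.
    rewrite inventory_repeatsE ?mem_rep ?xs ?orbT // (permP permA) /=.
    rewrite mem_filter mem_undup xs andbT negbK.
    by case: eqP => // nox; rewrite nox xs in no_s.
  by [].
have size' : size s' <= 3.
  by move: size4; rewrite (perm_size perm').
have n'o : ndistinct (inventory A) - (growth a ys + size s) = n - size s.
  by rewrite n'E; lia.
split.
- split=> //; [by rewrite mem_inventory A1 | by rewrite n'E; lia | by rewrite n'E; lia].
- by rewrite n'o.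
- move=> v; rewrite mem_sort mem_filter mem_iota => /andP[v1].
  rewrite inE => /orP[/eqP vE|]; first by move: v1; rewrite vE; case: (a).
  case/mapP=> x _ vE; have := leq_trans (count_size (pred1 x) s) s3.
  by move: v1; rewrite vE; case: (x \notin ys); lia.
- move=> k; rewrite mem_filter mem_inventory => /andP[/andP[gk /orP[/eqP ko|kK]] _].
    have -> : ndistinct (inventory A) - k = n - o by rewrite n'E; lia.
    by rewrite (mem_mult (n - o)) ?orbT // mem_rep eqxx.
  have -> : ndistinct (inventory A) - k = n - (k - growth a ys) by rewrite n'E; lia.
  by rewrite KA.
move=> x; rewrite mem_filter mem_inventory => /andP[/orP[/CA -> //|xs] _].
by rewrite (mem_mult x) ?orbT // mem_rep xs orbT.
Qed.

Lemma represents_succ (A : {mset nat}) (st : rel_state) :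
  represents A st -> size (repeats (inventory A)) <= 4 ->
  exists2 gs, gs \in rel_succ st &
    ndistinct (inventory A) = ndistinct A + gs.1 /\ represents (inventory A) gs.2.
Proof.
move=> repA size4; have := represents_next _ _ repA size4.
case: st repA => [[s o] [K C]] [_ _ _ KA CA].
set a := _ \in A; set ys := filter _ _ => -[cardE rep'].
exists (growth a ys, rel_next a ys (s, o, (K, C))) => //.
apply: allpairs_f; first by rewrite /a; case: ifP => [/KA ->|]; case: (_ \in A).
have -> : ys = [seq x <- [seq x <- undup s | x \notin C] | x \notin A].
  rewrite -filter_predI; apply: eq_filter => x /=.
  by apply/idP/andP=> [xA|[]//]; split=> //; apply: contra xA => /CA.
exact: mem_sublists.
Qed.

Lemma represents_known (A : {mset nat}) (st : rel_state) :
  represents A st -> known st -> size (repeats (inventory A)) <= 4 ->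
  ndistinct (inventory A) = ndistinct A /\ represents (inventory A) (rel_next true [::] st).
Proof.
move=> repA knownst size4; have := represents_next _ _ repA size4.
case: st repA knownst => [[s o] [K C]] [_ _ _ KA CA] /andP[oK /allP sC].
rewrite (KA _ oK) (eq_in_filter (a2 := pred0)) ?filter_pred0 /growth ?addn0 //.
by move=> x; rewrite mem_undup => /sC /CA ->.
Qed.

Lemma represents_cyclic (A : {mset nat}) (t : nat) (st : rel_state) :
  (forall i, t <= i -> size (repeats (iter i inventory A)) <= 4) ->
  represents (iter t inventory A) st -> cyclic st -> recurs A t.+2.
Proof.
move=> size4 rep /andP[kn]; have [c1 rep1] := represents_known _ _ rep kn (size4 t.+1 (leqnSn t)).
case/orP=> [/eqP eqst|/andP[kn1 /eqP eqst]].
  rewrite eqst in rep1; exists t, t.+1; split=> //; rewrite ?iterS ?c1 //.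
  exact: (represents_perm _ _ st).
have [c2 rep2] := represents_known _ _ rep1 kn1 (size4 t.+2 (leq_trans (leqnSn t) (leqnSn _))).
rewrite eqst in rep2; exists t, t.+2; split=> //; rewrite ?iterS ?c2 ?c1 //.
by apply: (represents_perm _ _ st); rewrite ?c2 ?c1.
Qed.

(* A step may increase the potential e.2 by at most 2g - 1 where g is the growth of n;
   cyclic states are exempt since they force a repetition within two steps. *)
Definition potential_ok (T : seq (rel_state * nat)) : bool :=
  all (fun e => cyclic e.1 ||
    all (fun gs => has (fun e' => (e'.1 == gs.2) && (e'.2 < e.2 + gs.1.*2)) T)
        (rel_succ e.1)) T.

Lemma recurs_leq (A : {mset nat}) (t u : nat) : t <= u -> recurs A t -> recurs A u.
Proof.
move=> tu [i [j [ij jt eqc eqr]]]; exists i, j; split=> //; exact: leq_trans tu.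
Qed.

(** Along the run, 2n minus the potential rises by at least 1 per step. The extra 1 covers a cyclic
    state met with a single step left. *)
Lemma potential_bound (A : {mset nat}) (T : seq (rel_state * nat)) (j t : nat)
    (st : rel_state) (v : nat) :
  potential_ok T -> (st, v) \in T ->
  (forall i, t <= i -> size (repeats (iter i inventory A)) <= 4) ->
  represents (iter t inventory A) st -> ~ recurs A (t + j) ->
  j + (ndistinct (iter t inventory A)).*2 <= (ndistinct (iter (t + j) inventory A)).*2 + v.+1.
Proof.
move=> Tok; elim: j t st v => [|j IH] t st v stT size4 rep nrec.
  by rewrite addn0; lia.
have mono := leq_ndistinct_iter A t (t + j.+1) (leq_addr _ _).
case: (posnP j) mono => [-> | j0] mono; first by lia.
have /allP/(_ _ stT)/orP[cyc|/allP succ_ok] := Tok.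
  case: nrec; apply: recurs_leq (represents_cyclic _ _ _ size4 rep cyc); lia.
have [gs gsT [cE rep']] := represents_succ _ _ rep (size4 t.+1 (leqnSn t)).
have [v' v'lt st'T] : exists2 v' : nat, v' < v + gs.1.*2 & (gs.2, v') \in T.
  by have /hasP[[st' v'] st'T /andP[/eqP <- ?]] := succ_ok _ gsT; exists v'.
have := IH t.+1 gs.2 v' st'T (fun i ti => size4 i (ltnW ti)).
by rewrite addSnnS iterS cE => /(_ rep' nrec); lia.
Qed.

(** The excesses sum to at most 4, and o <= 4 + 4 - 1 with at most four new elements and four
    repeats. *)
Definition rel_init : seq rel_state :=
  [seq (map S p, o, ([::], [::]))
     | p <- [seq p <- partitions 4 1 4 | size p <= 3], o <- iota 0 8].

(* The table is produced by an uncertified search for the reachable states followed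
   by Bellman iterations; only its final validity is proved. *)
Definition closure_step (p : seq rel_state * seq rel_state) :=
  let: (seen, todo) := p in
  let new := undup [seq st' <- flatten [seq if cyclic st then [::]
                                            else map snd (rel_succ st) | st <- todo]
                    | st' \notin seen] in
  (new ++ seen, new).

Definition bellman_step (T : seq (rel_state * nat)) : seq (rel_state * nat) :=
  let value st := (nth (st, 0) T (find (fun e => e.1 == st) T)).2 in
  [seq (e.1, if cyclic e.1 then 0 else
             foldr maxn 0 [seq (value gs.2).+1 - gs.1.*2 | gs <- rel_succ e.1])
     | e <- T].

Lemma exists_potential :
  exists2 T, potential_ok T &
    {in rel_init, forall st, exists2 v, v <= 6 & (st, v) \in T}.
Proof.
suff [T /andP[Tok /allP initT]] : exists T, potential_ok T &&
    all (fun st => has (fun e => (e.1 == st) && (e.2 <= 6)) T) rel_init.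
  exists T => // st /initT /hasP[[st' v] stT /= /andP[/eqP <- v6]].
  by exists v.
let T := eval vm_compute in
  (iter 10 bellman_step
     [seq (st, 0) | st <- (iter 25 closure_step (rel_init, rel_init)).1]) in
exists T.
by vm_compute.
Qed.

(** The first step makes 1 present; the second then gives it a large multiplicity. *)
Lemma exists_represents (A : {mset nat}) :
  10 <= ndistinct A -> size (repeats A) <= 4 -> size (repeats (inventory A)) <= 4 ->
  size (repeats (inventory (inventory A))) <= 4 ->
  exists2 st, st \in rel_init & represents (inventory (inventory A)) st.
Proof.
set B := inventory A; move=> n10 eA eB eC.
have B1 : 1 \in B.
  rewrite mem_inventory; apply/orP; right.
  by rewrite -has_pred1 has_count count_mult_seq1; lia.
have nB : 10 <= ndistinct B by apply: leq_trans (leq_ndistinct_inventory A).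
have le_C : ndistinct (inventory B) <= ndistinct B + 4.
  rewrite ndistinct_inventory leq_add2l (permP (perm_undup_mult_seq B)) count_cat.
  rewrite count_nseq /= B1 mul0n add0n (leq_trans (count_size _ _)) //.
  exact: leq_trans (size_undup _) eB.
have ge_C := leq_ndistinct_inventory B.
have inv1 : inventory B 1 = (ndistinct B - size (repeats B)).+1.
  by rewrite inventory1E B1.
have permC : perm_eq (repeats (inventory B))
    ((ndistinct B - size (repeats B)).+1 :: small_repeats B).
  by rewrite (perm_trans (perm_small_repeats B)) //= inv1 ifT //; lia.
have sum_small := leq_trans (sumn_small_repeats B) eB.
have [p p4 sortE] := sort_partitions _ _ (small_repeats_gt1 B) sum_small.
have size_p : size p <= 3.
  by rewrite -(size_map S) -sortE size_sort -ltnS -[_.+1](perm_size permC).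
pose o := ndistinct (inventory B) - (ndistinct B - size (repeats B)).+1.
exists (map S p, o, ([::], [::])).
  apply: allpairs_f; first by rewrite mem_filter size_p.
  by rewrite mem_iota /o; lia.
have eB1 : 0 < size (repeats B).
  rewrite (perm_size (repeats_inventory A)) /= inventory1E.
  by rewrite ifT //; lia.
split; rewrite ?size_map //.
- by split=> //; [rewrite mem_inventory B1 | lia | rewrite /o; lia].
- rewrite /o subKn; last by lia.
  by rewrite (perm_trans permC) // perm_cons -sortE perm_sym perm_sort.
move=> v; rewrite -sortE mem_sort mem_iota => vs.
have v1 := small_repeats_gt1 B v vs.
have : v.-1 <= 4.
  apply: leq_trans sum_small.
  by rewrite (perm_sumn (perm_map _ (perm_to_rem vs))) /= leq_addr.
by lia.
Qed.

(** * The final count of steps *)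

Lemma recurs_dec (A : {mset nat}) (t : nat) : recurs A t \/ ~ recurs A t.
Proof.
pose f i := (ndistinct (iter i inventory A), sort leq (repeats (iter i inventory A))).
have fE i j : f i = f j <->
    ndistinct (iter i inventory A) = ndistinct (iter j inventory A) /\
    perm_eq (repeats (iter i inventory A)) (repeats (iter j inventory A)).
  have sortP := perm_sortP leq_total leq_trans anti_leq.
  by split=> [[-> /sortP] | [e /sortP e']]; rewrite /f ?e ?e'.
case: (boolP (uniq (mkseq f t.+1))) => [uf|/(uniqPn (f 0))[i [j]]].
  right=> -[i [j [ij jt en er]]]; move: (ltnn i); rewrite -{2}(_ : j = i) ?ij //.
  apply/esym/eqP; rewrite -(nth_uniq (f 0) _ _ uf) ?size_mkseq ?ltnS //.
    by rewrite !nth_mkseq ?ltnS //; [apply/eqP/fE | lia].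
  by lia.
rewrite size_mkseq => -[ij jt]; rewrite !nth_mkseq //; last exact: ltn_trans jt.
by case/fE=> en er; left; exists i, j.
Qed.

Lemma recurs_bound (A : {mset nat}) :
  pos_mset A -> recurs A (2 * mset_max (inventory A) + 60).
Proof.
move=> posA; set M := mset_max _; set N := 2 * M + 60.
case: (recurs_dec A N) => // nrecN; exfalso.
have nrec t : t <= N -> ~ recurs A t by move=> tN /(recurs_leq _ _ _ tN).
have le_B i := ndistinct_iter_le A i posA; rewrite -/M in le_B.
have posA1 := pos_mset_inventory posA.
have n1M : ndistinct (inventory A) <= M := ndistinct_le _ _ posA1 (mset_max_ge _).
have n1 : 0 < ndistinct (inventory A).
  case/andP: posA1 => nz _; rewrite lt0n; apply: contra nz => /eqP n0.
  apply/eqP/msetP=> x; rewrite mset0E; apply/eqP; rewrite mset_eq0 -msuppE.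
  apply/negP=> xA; have : 0 < ndistinct (inventory A) by rewrite -has_predT; apply/hasP; exists x.
  by rewrite n0.
have [M8 | M9] := leqP M 8.
  (* Here [maxn M.+1 7] is at most 9, so growth below 10 already exceeds the bound [le_B]. *)
  pose k := (maxn M.+1 7).+1 - ndistinct (inventory A).
  have tN : (7 * k).+1 <= N by rewrite /k /N; lia.
  have := ndistinct_grows _ _ n1 (nrec _ tN); have := le_B (7 * k).+1.
  by rewrite /k; lia.
pose k := 10 - ndistinct (inventory A).
have t1N : (7 * k).+1 <= 64 by rewrite /k; lia.
have n10 : 10 <= ndistinct (iter (7 * k).+1 inventory A).
  have := ndistinct_grows _ k n1 (nrec _ (leq_trans t1N _)).
  by rewrite /k => /(_ ltac:(rewrite /N; lia)); lia.
pose t := maxn (7 * k).+1 (2 * ndistinct A).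
have size4 i : t <= i -> size (repeats (iter i inventory A)) <= 4.
  by move=> ti; have := size_repeats_iter A i; rewrite /t in ti; lia.
have n10t : 10 <= ndistinct (iter t inventory A).
  by apply: leq_trans n10 _; apply: leq_ndistinct_iter; rewrite leq_maxl.
have [st st0 rep] := exists_represents _ n10t (size4 t (leqnn _))
  (size4 t.+1 (leqnSn _)) (size4 t.+2 (leq_trans (leqnSn _) (leqnSn _))).
have [T Tok /(_ st st0)[v v6 stT]] := exists_potential.
have n0n1 := leq_ndistinct_inventory A.
have tN : t.+2 <= N by rewrite /t /N; lia.
(* Since n_N <= M + 1, this gives 2n + 49 <= t for n at time [t.+2]; but n >= 10 excludes t <= 64,
   and n >= n_0 excludes t = 2 n_0. *)
have := potential_bound A T (N - t.+2) t.+2 st v Tok stT _ rep.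
rewrite subnKC // => /(_ _ nrecN) bound.
have {bound} := bound (fun i ti => size4 i (ltnW (ltnW ti))).
have := leq_trans n10t (leq_ndistinct_iter A t t.+2 (leqW (leqnSn t))).
have := leq_ndistinct_iter A 0 t.+2 (leq0n _).
have : t = maxn (7 * k).+1 (2 * ndistinct A) by [].
have := le_B N; have NE : N = 2 * M + 60 by [].
clearbody t N; rewrite [iter 0 _ _]/=.
move: (ndistinct (iter t.+2 _ _)) (ndistinct (iter N _ _)) => nt nN; lia.
Qed.

Theorem corollary8p4p1 (S : nat -> {mset nat})
    (hS0 : pos_mset (S 0))
    (hS : forall i : nat, S i.+1 = inventory (S i)) :
  exists p : nat, is_preperiod S p /\ p <= 2 * mset_max (S 1) + 60.
Proof.
have SE i : S i = iter i inventory (S 0) by elim: i => //= i <-.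
have [p [[loop_p minp] p_le]] := recurs_preperiod _ _ (recurs_bound _ hS0).
exists p; rewrite hS; split=> //; split=> [|q]; rewrite SE //; exact: minp.
Qed.
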